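(* Let $\mathscr T=(V,E)$ be a rootless and leafless directed tree. Let $S_{\boldsymbol\lambda}\in\boldsymbol B(\ell^2(V))$ be a centered weighted shift on $\mathscr T$ with nonzero weights $\boldsymbol\lambda=\{\lambda_v\}_{v\in V}$. If $$\lim_{n\to\infty}\frac{|\lambda_{\mathsf{par}^n(v)|v}|^2}{\|S_{\boldsymbol\lambda}^ne_{\mathsf{par}^n(v)}\|^2}=0\quad\text{for every }v\in V,$$ then $S_{\boldsymbol\lambda}$ is type I centered.
   Context: A directed tree $\mathscr T=(V,E)$ is a directed graph that is connected (as an undirected graph), has no directed circuits, and in which every vertex has at most one parent. $\mathsf{Chi}(u)=\{v\in V:(u,v)\in E\}$ is the set of children of $u$; $\mathsf{par}(u)$ is the parent of $u$ (the unique $v$ with $(v,u)\in E$), and $\mathsf{par}^n$ is the $n$-fold composition of $\mathsf{par}$. Rootless means every vertex has a parent; leafless means $\mathsf{Chi}(u)\neq\varnothing$ for all $u$. For a rootless tree and weights $\boldsymbol\lambda=\{\lambda_v\}_{v\in V}\subseteq\mathbb C$ with $\sup_{v\in V}\sum_{u\in\mathsf{Chi}(v)}|\lambda_u|^2<\infty$, the weighted shift $S_{\boldsymbol\lambda}$ on $\mathscr T$ is the bounded operator on $\ell^2(V)$ given by $(S_{\boldsymbol\lambda}f)(v)=\lambda_vf(\mathsf{par}(v))$, $v\in V$. $\{e_v\}_{v\in V}$ is the canonical orthonormal basis of $\ell^2(V)$, and $\lambda_{\mathsf{par}^n(v)|v}=\lambda_v\lambda_{\mathsf{par}(v)}\cdots\lambda_{\mathsf{par}^{n-1}(v)}$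 for $v\in V$, $n\geqslant1$. $\boldsymbol B(\mathcal H)$ denotes the bounded operators on $\mathcal H$; $\mathcal R(A)$ is the range of $A$. A bounded operator $T$ on a complex Hilbert space $\mathcal H$ is centered if all the operators $T^{n}T^{*n}$, $T^{*n}T^{n}$, $n\geqslant1$, commute with each other. Let $T=U|T|$ be the polar decomposition ($U$ a partial isometry with $\ker U=\ker T$). A centered $T$ is type I centered if $U$ is a pure isometry (an isometry without nonzero unitary part); equivalently, $\bigcap_{n=1}^\infty\overline{\mathcal R(T^n)}=\{0\}$ and $\bigcap_{n=1}^\infty\overline{\mathcal R(|T^n|)}=\mathcal H$. *)

(* Defs.v *)
From HB Require Import structures.
From mathcomp Require Import all_boot all_order all_algebra finmap complex.
From mathcomp Require Import sesquilinear.
From mathcomp Require Import all_classical all_reals all_analysis.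
From mathcomp Require summability.
From mathcomp Require Import ring lra.

Set Implicit Arguments.
Unset Strict Implicit.
Unset Printing Implicit Defensive.

Import Order.TTheory GRing.Theory Num.Theory.
Import numFieldNormedType.Exports.

Local Open Scope classical_set_scope.
Local Open Scope ring_scope.

(* The inner product is linear in its first argument, conjugate-linear in the
   second. *)
HB.mixin Record CompleteNormedModule_isHilbert (R : realType) (H : Type)
    & CompleteNormedModule R[i] H := {
  inner : {dot H for @Num.conj R[i]} ;
  sqr_norm_inner : forall x : H, `|x| ^+ 2 = inner x x }.

#[short(type="hilbertType")]
HB.structure Definition Hilbert (R : realType) :=
  {H of CompleteNormedModule R[i] H & CompleteNormedModule_isHilbert R H}.

Section operators.
Variables (R : realType) (H : hilbertType R).
Implicit Types (T U P : H -> H) (M : set H) (n : nat) (x y : H).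

Definition bounded_operator T :=
  linear T /\ exists c : R[i], forall x, `|T x| <= c * `|x|.

(* The adjoint of a bounded operator exists and is unique; outside of the
   bounded operators the value is irrelevant. *)
Definition adjoint T : H -> H :=
  xget (idfun : H -> H) [set T' : H -> H | forall x y, inner (T x) y = inner x (T' y)].

Definition centered T :=
  let family := [set A : H -> H | exists2 n, (1 <= n)%N &
      A = iter n T \o iter n (adjoint T) \/
      A = iter n (adjoint T) \o iter n T] in
  bounded_operator T /\
  (forall A B, family A -> family B -> A \o B = B \o A).

Definition positive_operator P :=
  bounded_operator P /\ forall x, 0 <= inner (P x) x.

(* [P] is the positive square root [|T|] of [T^* T]. *)
Definition is_modulus T P :=
  positive_operator P /\ P \o P = adjoint T \o T.

Definition partial_isometry U :=
  bounded_operator U /\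
  forall x, (forall y, U y = 0 -> inner x y = 0) -> `|U x| = `|x|.

Definition polar_decomposition T U P :=
  [/\ is_modulus T P, partial_isometry U,
      (forall x, U x = 0 <-> T x = 0) & T = U \o P].

Definition isometric_operator U :=
  bounded_operator U /\ forall x, `|U x| = `|x|.

Definition closed_subspace M :=
  [/\ closed M, M 0 & forall (a : R[i]) x y, M x -> M y -> M (a *: x + y)].

Definition reducing T M :=
  [/\ closed_subspace M, T @` M `<=` M & adjoint T @` M `<=` M].

(* The restriction of [T] to [M] is a unitary operator of [M]. *)
Definition unitary_on T M :=
  T @` M = M /\ forall x, M x -> `|T x| = `|x|.

Definition pure_isometry U :=
  isometric_operator U /\
  forall M, reducing U M -> unitary_on U M -> M = [set 0].

Definition type_I_centered T :=
  centered T /\ exists U P, polar_decomposition T U P /\ pure_isometry U.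

End operators.

#[global] Existing Instance summability.totally_filter.

Section sums.
Variables (R : realType) (V : choiceType).
Implicit Types (a : V -> R) (h : V -> R[i]).

(* The modulus as an element of [R]; [`|z|] is its image in [R[i]]. *)
Definition cnorm (z : R[i]) : R := Normc.normc z.

Lemma cnormE z : (cnorm z)%:C%C = `|z|.
Proof. by []. Qed.

Lemma partial_sumE (U : zmodType) (h : V -> U) (A : {fset V}) :
  summability.partial_sum h A = \sum_(v <- A) h v.
Proof. by rewrite /summability.partial_sum (big_seq_fsetE _ _ xpredT). Qed.

Lemma esum_partial_le a (M : \bar R) : (forall v, 0 <= a v) ->
  (forall A : {fset V}, ((\sum_(v <- A) a v)%:E <= M)%E) ->
  (\esum_(v in [set: V]) (a v)%:E <= M)%E.
Proof.
move=> a0 aM; rewrite /esum; apply: ge_ereal_sup => _ [X [finX _] <-].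
rewrite (fsbig_finite _ _ finX)/= sumEFin.
by have := aM (fset_set X).
Qed.

Lemma partial_le_esum a (A : {fset V}) : (forall v, 0 <= a v) ->
  ((\sum_(v <- A) a v)%:E <= \esum_(v in [set: V]) (a v)%:E)%E.
Proof.
move=> a0; apply: esum_ge; exists [set` A]; first by split.
rewrite (fsbig_finite _ _ (finite_fset A))/= sumEFin set_fsetK//.
Qed.

Lemma partial_sum_cvg a : (forall v, 0 <= a v) ->
  (\esum_(v in [set: V]) (a v)%:E < +oo)%E ->
  summability.partial_sum a @ summability.totally -->
    (fine (\esum_(v in [set: V]) (a v)%:E) : R).
Proof.
move=> a0 afin; set s := fine _.
have sE : \esum_(v in [set: V]) (a v)%:E = s%:E.
  rewrite fineK// ge0_fin_numE//; apply: esum_ge0 => v _; rewrite lee_fin//.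
apply/cvgrPdist_le => e e0.
have [A As] : exists A : {fset V}, s - e < \sum_(v <- A) a v.
  apply: contrapT => /forallNP nA.
  have : (\esum_(v in [set: V]) (a v)%:E <= (s - e)%:E)%E.
    apply: esum_partial_le => // A; rewrite lee_fin leNgt; exact/negP/nA.
  by rewrite sE lee_fin leNgt ltrBlDr ltrDl e0.
exists A => //= B /= AB; rewrite partial_sumE.
have Bs : \sum_(v <- B) a v <= s.
  by rewrite -lee_fin -sE; exact: partial_le_esum.
rewrite ger0_norm ?subr_ge0//.
rewrite lerBlDr -lerBlDl ltW//; apply: (lt_le_trans As).
rewrite (big_fsetID _ (mem A) B)/=.
have -> : [fset v in B | v \in A]%fset = A.
  by apply/fsetP => v; rewrite !inE andb_idl// => /(fsubsetP AB).
by rewrite lerDl sumr_ge0.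
Qed.


Lemma partial_sum_real_complex a (l : R) :
  summability.partial_sum a @ summability.totally --> l ->
  summability.partial_sum (fun v => (a v)%:C%C : R[i]^o) @ summability.totally
    --> (l%:C%C : R[i]^o).
Proof.
move=> al; apply/cvgrPdist_le => e e0.
have Ree : 0 < complex.Re e by move: e0; rewrite ltcE => /andP[].
have /cvgrPdist_le/(_ _ Ree) := al; apply: filterS => A.
rewrite !partial_sumE -rmorph_sum/= -rmorphB/= => le_e.
have -> : `|(l - \sum_(v <- A) a v)%:C%C : R[i]^o| = `|l - \sum_(v <- A) a v|%:C%C :> R[i].
  by rewrite normc_def/= expr0n addr0 sqrtr_sqr.
by rewrite -(RRe_real (gtr0_real e0)) lecR.
Qed.

Definition abs_summable h := (\esum_(v in [set: V]) (cnorm (h v))%:E < +oo)%E.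

Lemma cnorm_ge0 z : 0 <= cnorm z. Proof. by case: z => x y; exact: sqrtr_ge0. Qed.

Lemma abs_summable_real_cvg a h : abs_summable h ->
  (forall v, `|a v| <= cnorm (h v)) ->
  cvg (summability.partial_sum a @ summability.totally).
Proof.
move=> hs ah.
have s (b : V -> R) : (forall v, `|b v| <= cnorm (h v)) ->
    cvg (summability.partial_sum (fun v => Num.max (b v) 0) @ summability.totally).
  move=> bh; apply/cvg_ex; eexists; apply: partial_sum_cvg => [v|].
    by rewrite le_max lexx orbT.
  apply: le_lt_trans hs; apply: le_esum => v _; rewrite lee_fin.
  by rewrite ge_max cnorm_ge0 (le_trans (ler_norm _)).
have sN : forall v, `|- a v| <= cnorm (h v) by move=> v; rewrite normrN.
have -> : summability.partial_sum a =
    summability.partial_sum (fun v => Num.max (a v) 0) \-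
    summability.partial_sum (fun v => Num.max (- a v) 0).
  apply/funext => A; rewrite /= !partial_sumE -sumrB; apply: eq_bigr => v _.
  case: (leP (a v) 0) => av.
    by rewrite max_l ?oppr_ge0// sub0r opprK.
  by rewrite max_r ?oppr_le0 ?ltW// subr0.
exact: (is_cvgB (s _ ah) (s _ sN)).
Qed.

Lemma abs_summable_cvg h : abs_summable h ->
  cvg (summability.partial_sum (h : V -> R[i]^o) @ summability.totally).
Proof.
move=> hs.
have /cvg_ex[x ax] : cvg (summability.partial_sum (fun v => complex.Re (h v)) @ summability.totally).
  apply: (abs_summable_real_cvg hs) => v; rewrite -lecR cnormE.
  exact: normc_ge_Re.
have /cvg_ex[y ay] : cvg (summability.partial_sum (fun v => complex.Im (h v)) @ summability.totally).
  apply: (abs_summable_real_cvg hs) => v; rewrite -lecR cnormE.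
  case: (h v) => p q; rewrite normc_def/= lecR -[leLHS]sqrtr_sqr ler_wsqrtr//.
  by rewrite lerDr sqr_ge0.
have -> : summability.partial_sum (h : V -> R[i]^o) =
    summability.partial_sum (fun v => (complex.Re (h v))%:C%C : R[i]^o) \+
    (fun A => 'i%C *: summability.partial_sum (fun v => (complex.Im (h v))%:C%C : R[i]^o) A).
  apply/funext => A; rewrite /= !partial_sumE scaler_sumr -big_split/=.
  by apply: eq_bigr => v _; rewrite [LHS]complexE.
apply/cvg_ex; eexists; apply: cvgD; first exact: (partial_sum_real_complex ax).
by apply: cvgZr; exact: (partial_sum_real_complex ay).
Qed.

End sums.

Section net_sums.
Variables (R : realType) (V : choiceType).
Implicit Types (h k : V -> R[i]).

(* The unconditional sum: the limit over the finite subsets of [V]. *)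
Definition csum h : R[i] := summability.sum (h : V -> R[i]^o).

Lemma csum_cvg h : abs_summable h ->
  summability.partial_sum (h : V -> R[i]^o) @ summability.totally
    --> (csum h : R[i]^o).
Proof. by move=> /abs_summable_cvg. Qed.

Lemma csum_unique h (l : R[i]) :
  summability.partial_sum (h : V -> R[i]^o) @ summability.totally
    --> (l : R[i]^o) -> csum h = l.
Proof. by move=> hl; rewrite /csum; apply: (@cvg_lim R[i]^o) hl; exact: norm_hausdorff. Qed.

Lemma csum_linear (c : R[i]) h k : abs_summable h -> abs_summable k ->
  csum (fun v => c * h v + k v) = c * csum h + csum k.
Proof.
move=> hs ks; apply: csum_unique.
have -> : summability.partial_sum (fun v => c * h v + k v : R[i]^o) =
    (fun A => c *: summability.partial_sum (h : V -> R[i]^o) A) \+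
    summability.partial_sum (k : V -> R[i]^o).
  by apply/funext => A; rewrite /= !partial_sumE scaler_sumr -big_split.
apply: (@cvgD _ R[i]^o); last exact: csum_cvg.
by apply: cvgZr; exact: csum_cvg.
Qed.

Lemma csum_conj h : abs_summable h ->
  csum (fun v => Num.conj (h v)) = Num.conj (csum h).
Proof.
move=> hs; apply: csum_unique.
apply/cvgrPdist_le => e e0.
have /cvgrPdist_le/(_ _ e0) := csum_cvg hs; apply: filterS => A.
rewrite !partial_sumE.
by rewrite -rmorph_sum/= -rmorphB/= (@norm_conjC R[i]).
Qed.

End net_sums.

Section square_summable.
Variables (R : realType) (V : choiceType).
Implicit Types (f g : V -> R[i]).

Definition sqsum f : \bar R := \esum_(v in [set: V]) (cnorm (f v) ^+ 2)%:E.

Definition square_summable : {pred V -> R[i]} :=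
  fun f => `[< (sqsum f < +oo)%E >].

Lemma sqsum_ge0 f : (0 <= sqsum f)%E.
Proof. by apply: esum_ge0 => v _; rewrite lee_fin sqr_ge0. Qed.

Lemma sqsum_fineK f : f \in square_summable -> (fine (sqsum f))%:E = sqsum f.
Proof.
by move=> /asboolP ff; rewrite fineK// ge0_fin_numE// sqsum_ge0.
Qed.

Lemma sqsum_partial_le f (M : \bar R) :
  (forall A : {fset V}, ((\sum_(v <- A) cnorm (f v) ^+ 2)%:E <= M)%E) ->
  (sqsum f <= M)%E.
Proof. by move=> fM; apply: esum_partial_le => // v; exact: sqr_ge0. Qed.

Lemma partial_le_sqsum f (A : {fset V}) : f \in square_summable ->
  \sum_(v <- A) cnorm (f v) ^+ 2 <= fine (sqsum f).
Proof.
move=> fs; rewrite -lee_fin sqsum_fineK//.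
by apply: partial_le_esum => v; exact: sqr_ge0.
Qed.

Lemma cnormM (x y : R[i]) : cnorm (x * y) = cnorm x * cnorm y.
Proof. exact: Normc.normcM. Qed.

Lemma cnormD (x y : R[i]) : cnorm (x + y) <= cnorm x + cnorm y.
Proof. by rewrite -lecR rmorphD/= !cnormE ler_normD. Qed.

Lemma cnorm_conj (x : R[i]) : cnorm (Num.conj x) = cnorm x.
Proof. by case: x => p q; rewrite /cnorm/= sqrrN. Qed.

Lemma square_summable_submod : submod_closed square_summable.
Proof.
split=> [|a f g fs gs].
  apply/asboolP; rewrite /sqsum esum1// => v _.
  by rewrite /cnorm Normc.normc0 expr0n.
apply/asboolP.
apply: (@le_lt_trans _ _
    ((2 * cnorm a ^+ 2) * fine (sqsum f) + 2 * fine (sqsum g))%:E); last first.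
  exact: ltry.
apply: sqsum_partial_le => A; rewrite lee_fin.
apply: le_trans (lerD (ler_wpM2l _ (partial_le_sqsum A fs))
                      (ler_wpM2l _ (partial_le_sqsum A gs))); last 2 first.
  by rewrite mulr_ge0// sqr_ge0.
  by [].
rewrite !mulr_sumr -big_split/=; apply: ler_sum => v _.
rewrite -mulrA -exprMn -cnormM -mulrDr.
apply: (@le_trans _ _ ((cnorm (a * f v) + cnorm (g v)) ^+ 2)).
  by rewrite lerXn2r ?nnegrE ?addr_ge0 ?cnorm_ge0 ?cnormD.
rewrite sqrrD -subr_ge0.
rewrite [X in 0 <= X](_ : _ = (cnorm (a * f v) - cnorm (g v)) ^+ 2) ?sqr_ge0//.
by ring.
Qed.

HB.instance Definition _ := GRing.isSubmodClosed.Build R[i] (V -> R[i])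
  square_summable square_summable_submod.

End square_summable.

Record l2 (R : realType) (V : choiceType) := L2 {
  l2_fun :> V -> R[i] ;
  l2_square_summable : l2_fun \in @square_summable R V }.

Section l2_lmodule.
Variables (R : realType) (V : choiceType).

HB.instance Definition _ := [isSub for @l2_fun R V].
HB.instance Definition _ := [Choice of l2 R V by <:].
HB.instance Definition _ := [SubChoice_isSubLmodule of l2 R V by <:].

End l2_lmodule.

Section dot_product.
Variables (R : realType) (U : lmodType R[i]).
Variable form : {dot U for @Num.conj R[i]}.
Local Notation "''[' u , v ]" := (form u v) : ring_scope.

Lemma dot_ge0 u : 0 <= '[u, u].
Proof.
have [->|u0] := eqVneq u 0; first by rewrite linear0r.
by rewrite ltW// neq0_dnorm_gt0.
Qed.

Lemma dot_conj u v : '[v, u] = Num.conj '[u, v].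
Proof. by rewrite (hermC form) /= expr0 mul1r. Qed.

Lemma dot_CauchySchwarz u v : `|'[u, v]| ^+ 2 <= '[u, u] * '[v, v].
Proof.
have [->|v0] := eqVneq v 0.
  by rewrite [X in _ * X]linear0r mulr0 linear0r normr0 expr0n.
have vv : 0 < '[v, v] by exact: neq0_dnorm_gt0.
have vvR : Num.conj '[v, v] = '[v, v] by rewrite -dot_conj.
have E a : '[u - a *: v, u - a *: v] =
    '[u, u] - Num.conj a * '[u, v] - a * Num.conj '[u, v]
    + a * Num.conj a * '[v, v].
  have Zl x y : '[a *: x, y] = a * '[x, y] by rewrite linearZl_LR.
  have Zr x y : '[x, a *: y] = Num.conj a * '[x, y] by rewrite linearZr_LR.
  rewrite linearBl/= !linearBr/= !Zl !Zr [in '[v, u]]dot_conj.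
  by ring.
have := dot_ge0 (u - ('[u, v] / '[v, v]) *: v).
rewrite E rmorphM/= fmorphV/= vvR.
rewrite (_ : _ + _ = '[u, u] - '[u, v] * Num.conj '[u, v] / '[v, v]); last first.
  by field; rewrite gt_eqF.
by rewrite -normCK subr_ge0 ler_pdivrMr.
Qed.

Lemma dot_triangle u v :
  sqrtC '[u + v, u + v] <= sqrtC '[u, u] + sqrtC '[v, v].
Proof.
rewrite -(@ler_sqr R[i]) ?nnegrE ?addr_ge0 ?sqrtC_ge0 ?dot_ge0//.
rewrite sqrrD !sqrtCK linearDl/= !linearDr/= [in '[v, u]]dot_conj.
rewrite -!addrA lerD2l !addrA lerD2r.
have uv : `|'[u, v]| <= sqrtC '[u, u] * sqrtC '[v, v].
  rewrite -(@ler_sqr R[i]) ?nnegrE ?mulr_ge0 ?sqrtC_ge0 ?dot_ge0//.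
  by rewrite exprMn !sqrtCK dot_CauchySchwarz.
apply: (@le_trans _ _ (`|'[u, v]| *+ 2)); last by rewrite lerMn2r.
have /le_trans -> //: '[u, v] + Num.conj '[u, v] <= `|'[u, v] + Num.conj '[u, v]|.
  by rewrite real_ler_norm// CrealE rmorphD/= conjCK addrC.
by rewrite (le_trans (ler_normD _ _))// norm_conjC mulr2n.
Qed.

End dot_product.

Section l2_inner.
Variables (R : realType) (V : choiceType).
Implicit Types (f g h : l2 R V).

Definition l2_inner f g : R[i] := csum (fun v => f v * Num.conj (g v)).

Lemma l2_inner_summable f g :
  abs_summable (fun v => f v * Num.conj (g v)).
Proof.
apply: (@le_lt_trans _ _ (fine (sqsum f) + fine (sqsum g))%:E); last exact: ltry.
apply: esum_partial_le => [v|A]; first exact: cnorm_ge0.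
rewrite lee_fin.
apply: le_trans (lerD (partial_le_sqsum A (l2_square_summable f))
                      (partial_le_sqsum A (l2_square_summable g))).
rewrite -big_split/=; apply: ler_sum => v _.
rewrite cnormM cnorm_conj.
have := sqr_ge0 (cnorm (f v) - cnorm (g v)).
have := mulr_ge0 (cnorm_ge0 (f v)) (cnorm_ge0 (g v)).
set x := cnorm _; set y := cnorm _ => xy0 xy; nra.
Qed.

Lemma l2_innerDl a f g h :
  l2_inner (a *: f + g) h = a * l2_inner f h + l2_inner g h.
Proof.
rewrite /l2_inner -csum_linear; [|exact: l2_inner_summable..].
by congr csum; apply/funext => v; rewrite mulrDl -mulrA.
Qed.

Lemma l2_innerC f g : l2_inner f g = Num.conj (l2_inner g f).
Proof.
rewrite /l2_inner -csum_conj; last exact: l2_inner_summable.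
by congr csum; apply/funext => v; rewrite rmorphM/= conjCK mulrC.
Qed.

Lemma l2_innerDr a f g h :
  l2_inner h (a *: f + g) = Num.conj a * l2_inner h f + l2_inner h g.
Proof.
by rewrite l2_innerC l2_innerDl rmorphD rmorphM/= -!l2_innerC.
Qed.

Lemma l2_inner_diag f : l2_inner f f = (fine (sqsum f))%:C%C.
Proof.
apply: csum_unique.
have -> : (fun v => f v * Num.conj (f v) : R[i]^o) =
    (fun v => (cnorm (f v) ^+ 2)%:C%C : R[i]^o).
  by apply/funext => v; rewrite -normCK rmorphXn/= cnormE.
apply: partial_sum_real_complex; apply: partial_sum_cvg => [v|].
  exact: sqr_ge0.
exact/asboolP/l2_square_summable.
Qed.

Lemma l2_inner_bilinear : bilinear_for
  (GRing.Scale.Law.clone _ _ *%R _)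
  (GRing.Scale.Law.clone _ _ (Num.conj \; *%R) _) l2_inner.
Proof.
by split => [h a f g|h a f g]; [exact: l2_innerDl|exact: l2_innerDr].
Qed.

HB.instance Definition _ := bilinear_isBilinear.Build R[i] (l2 R V) (l2 R V)
  R[i] _ _ l2_inner l2_inner_bilinear.

Lemma l2_inner_hermitian f g :
  l2_inner f g = (-1) ^+ false * Num.conj (l2_inner g f).
Proof. by rewrite expr0 mul1r -l2_innerC. Qed.

HB.instance Definition _ := isHermitianSesquilinear.Build R[i] (l2 R V)
  false Num.conj l2_inner l2_inner_hermitian.

Lemma le_coord_l2 f v : cnorm (f v) ^+ 2 <= fine (sqsum f).
Proof.
have := partial_le_sqsum [fset v]%fset (l2_square_summable f).
by rewrite big_seq_fset1.
Qed.

Lemma l2P f g : (f : V -> R[i]) = g -> f = g.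
Proof. exact: val_inj. Qed.

Lemma l2_inner_gt0 f : f != 0 -> 0 < l2_inner f f.
Proof.
move=> f0; rewrite l2_inner_diag ltcR lt_neqAle andbC.
rewrite -lee_fin sqsum_fineK ?l2_square_summable// sqsum_ge0/= eq_sym.
apply: contra f0 => /eqP f0; apply/eqP/l2P/funext => v.
apply: Normc.eq0_normc; apply/eqP; rewrite -sqrf_eq0 eq_le sqr_ge0 andbT.
by rewrite -f0 le_coord_l2.
Qed.

HB.instance Definition _ := isDotProduct.Build R[i] (l2 R V) l2_inner l2_inner_gt0.

Definition l2_dot : {dot l2 R V for @Num.conj R[i]} := l2_inner.

Definition l2_norm f : R[i] := sqrtC (l2_inner f f).

Lemma l2_norm_triangle f g : l2_norm (f + g) <= l2_norm f + l2_norm g.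
Proof. exact: (dot_triangle l2_dot). Qed.

Lemma l2_normZ a f : l2_norm (a *: f) = `|a| * l2_norm f.
Proof.
have E : l2_inner (a *: f) (a *: f) = `|a| ^+ 2 * l2_inner f f.
  rewrite (_ : l2_inner _ _ = l2_dot (a *: f) (a *: f))//.
  by rewrite linearZl_LR/= linearZr_LR/= normCK mulrA.
rewrite /l2_norm E rootCMl ?exprn_ge0//.
by rewrite -[X in sqrtC X]/(_ ^+ 2) sqrCK.
Qed.

Lemma l2_norm_eq0 f : l2_norm f = 0 -> f = 0.
Proof.
move/eqP; rewrite sqrtC_eq0 => ff; apply/eqP.
by apply: contraTT ff => /l2_inner_gt0; rewrite lt0r => /andP[].
Qed.

End l2_inner.

HB.instance Definition _ (R : realType) (V : choiceType) :=
  Lmodule_isNormed.Build R[i] (l2 R V)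
    (@l2_norm_triangle R V) (@l2_normZ R V) (@l2_norm_eq0 R V).

Section l2_complete.
Variables (R : realType) (V : choiceType).
Implicit Types (f g : l2 R V).

Lemma sqr_l2_norm f : `|f| ^+ 2 = (fine (sqsum f))%:C%C.
Proof. by rewrite -l2_inner_diag -[LHS]/(l2_norm f ^+ 2) sqrtCK. Qed.

Lemma coord_le_l2_norm f v : `|f v| <= `|f|.
Proof.
rewrite -(@ler_sqr R[i]) ?nnegrE// sqr_l2_norm.
by rewrite -(cnormE (f v)) -rmorphXn lecR le_coord_l2.
Qed.

Lemma l2_norm_le f (e : R) : 0 <= e ->
  (forall A : {fset V}, \sum_(v <- A) cnorm (f v) ^+ 2 <= e ^+ 2) ->
  `|f| <= e%:C%C.
Proof.
move=> e0 fe; rewrite -(@ler_sqr R[i]) ?nnegrE ?lecR// sqr_l2_norm.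
rewrite -rmorphXn lecR -lee_fin sqsum_fineK ?l2_square_summable//.
by apply: sqsum_partial_le => A; rewrite lee_fin.
Qed.

Lemma l2_partial_le_norm f (A : {fset V}) (e : R) : `|f| <= e%:C%C ->
  \sum_(v <- A) cnorm (f v) ^+ 2 <= e ^+ 2.
Proof.
move=> fe; apply: (le_trans (partial_le_sqsum A (l2_square_summable f))).
rewrite -lecR -sqr_l2_norm rmorphXn/= ler_sqr ?nnegrE//.
exact: le_trans fe.
Qed.

Lemma l2_cauchy_coord (F : set_system (l2 R V)) (p : R[i] -> R) v :
  (forall x y, `|p x - p y|%:C%C <= `|x - y|) ->
  ProperFilter F -> cauchy F -> cvg ((fun f : l2 R V => p (f v)) @ F).
Proof.
move=> p1 FF /cauchy_ballP Fc.
apply/cauchy_cvgP/cauchy_ballP => e e0.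
have e0' : 0 < e%:C%C :> R[i] by rewrite ltcR.
have [[A B] /= [FA FB] AB] := Fc _ e0'.
exists ([set p (f v) | f in A], [set p (f v) | f in B]).
  by split; [apply: filterS FA|apply: filterS FB] => f Ff; exists f.
move=> [_ _] [/= [f Af <-] [g Bg <-]].
have := AB (f, g) (conj Af Bg); rewrite -!ball_normE /ball_/=.
rewrite -[X in X -> _]/(is_true (`|f - g| < e%:C%C)) => fge.
rewrite -ltcR; apply: le_lt_trans fge.
exact: le_trans (p1 _ _) (coord_le_l2_norm (f - g) v).
Qed.

Lemma cnorm_sqr (z : R[i]) :
  cnorm z ^+ 2 = complex.Re z ^+ 2 + complex.Im z ^+ 2.
Proof. by case: z => x y; rewrite /cnorm/= sqr_sqrtr// addr_ge0// sqr_ge0. Qed.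

Lemma cvg_sum_seq (T : Type) (F : set_system T) (s : seq V) (u : V -> T -> R)
    (l : V -> R) : Filter F -> (forall v, u v @ F --> l v) ->
  (fun t => \sum_(v <- s) u v t) @ F --> \sum_(v <- s) l v.
Proof.
move=> FF ul; elim: s => [|v s IHs].
  by rewrite big_nil; under eq_fun do rewrite big_nil; exact: cvg_cst.
by rewrite big_cons; under eq_fun do rewrite big_cons; exact: cvgD.
Qed.

Lemma l2_cauchy_limit (F : set_system (l2 R V)) :
  ProperFilter F -> cauchy F -> exists g : V -> R[i],
  forall (e : R), 0 < e -> F [set f : l2 R V | forall A : {fset V},
    \sum_(v <- A) cnorm (f v - g v) ^+ 2 <= e ^+ 2].
Proof.
move=> FF Fc.
have cRe v : cvg ((fun f : l2 R V => complex.Re (f v)) @ F).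
  apply: l2_cauchy_coord => // x y.
  rewrite -raddfB/=; exact: normc_ge_Re.
have cIm v : cvg ((fun f : l2 R V => complex.Im (f v)) @ F).
  apply: l2_cauchy_coord => // x y.
  rewrite -raddfB/=; case: (x - y) => p q; rewrite normc_def/= lecR.
  by rewrite -[leLHS]sqrtr_sqr ler_wsqrtr// lerDr sqr_ge0.
pose g v := (Complex (lim ((fun f : l2 R V => complex.Re (f v)) @ F))
                         (lim ((fun f : l2 R V => complex.Im (f v)) @ F))).
exists g => e e0.
have e0' : 0 < e%:C%C :> R[i] by rewrite ltcR.
move/cauchy_ballP : Fc => /(_ _ e0')[[B C] /= [FB FC] BC].
apply: filterS FB => f Bf A.
have lim_f : \sum_(v <- A) cnorm (f v - h v) ^+ 2 @[h --> F] -->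
    \sum_(v <- A) cnorm (f v - g v) ^+ 2.
  apply: cvg_sum_seq => v.
  rewrite cnorm_sqr !raddfB/=.
  under eq_fun do rewrite cnorm_sqr !raddfB/= !expr2.
  have cre : complex.Re (f v) - complex.Re (h v) @[h --> F] -->
      complex.Re (f v) - complex.Re (g v).
    by apply: cvgB; [exact: cvg_cst|exact: cRe].
  have cim : complex.Im (f v) - complex.Im (h v) @[h --> F] -->
      complex.Im (f v) - complex.Im (g v).
    by apply: cvgB; [exact: cvg_cst|exact: cIm].
  by rewrite !expr2; apply: cvgD; exact: cvgM.
rewrite -(cvg_lim _ lim_f)//; apply: limr_le.
  by apply/cvg_ex; eexists; exact: lim_f.
apply: filterS FC => h Ch.
apply: (l2_partial_le_norm (f := f - h)).
have := BC (f, h) (conj Bf Ch).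
by rewrite /= -ball_normE => /ltW.
Qed.

Lemma l2_cauchy_cvg (F : set_system (l2 R V)) :
  ProperFilter F -> cauchy F -> cvg F.
Proof.
move=> FF Fc; have [g gF] := l2_cauchy_limit FF Fc.
have gs : g \in @square_summable R V.
  have [f fg] := filter_ex (gF _ ltr01).
  have ds : (f : V -> R[i]) - g \in @square_summable R V.
    apply/asboolP; apply: (@le_lt_trans _ _ 1%:E); last exact: ltry.
    apply: sqsum_partial_le => A; rewrite lee_fin.
    by rewrite -[leRHS](expr1n _ 2); exact: fg.
  have -> : g = (f : V -> R[i]) - ((f : V -> R[i]) - g) by rewrite opprB addrC subrK.
  by rewrite rpredB// l2_square_summable.
apply/cvg_ex; exists (L2 gs); apply/cvgrPdist_le => e e0.
have Ree : 0 < complex.Re e by move: e0; rewrite ltcE => /andP[].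
apply: filterS (gF _ Ree) => f fg.
rewrite -(RRe_real (gtr0_real e0)) distrC.
by apply: l2_norm_le; [exact: ltW|move=> A; exact: fg].
Qed.

HB.instance Definition _ := Uniform_isComplete.Build (l2 R V) l2_cauchy_cvg.

Lemma sqr_norm_l2 f : `|f| ^+ 2 = l2_dot R V f f.
Proof. by rewrite sqr_l2_norm -l2_inner_diag. Qed.

HB.instance Definition _ :=
  CompleteNormedModule_isHilbert.Build R (l2 R V) sqr_norm_l2.

End l2_complete.

(* [ucycle E c] says that the vertices of [c] are distinct and that [c] is an
   [E]-cycle; [c = [:: v]] is the case of a loop at [v]. *)
Record directed_tree (V : choiceType) (E : rel V) : Prop := DirectedTree {
  tree_connected : forall u v, exists2 p : seq V,
    path (fun x y => E x y || E y x) u p & last u p = v ;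
  tree_acyclic : forall c : seq V, ucycle E c -> c = [::] ;
  tree_one_parent : forall u u' v, E u v -> E u' v -> u = u' }.

Section trees.
Variables (V : choiceType) (E : rel V).

Definition children (u : V) : set V := [set v | E u v].

(* A root is its own [par]; every other vertex of a directed tree is mapped to
   its unique parent. *)
Definition par (v : V) : V := xget v [set u | E u v].

Definition rootless := forall v, exists u, E u v.

Definition leafless := forall u, children u !=set0.

Lemma parP (u v : V) : directed_tree E -> rootless -> E u v <-> par v = u.
Proof.
move=> tE rE; split=> [uv|<-].
  exact: (tree_one_parent tE (xgetI v (uv : [set w | E w v] u)) uv).
have [w wv] := rE v; exact: (xgetI v (wv : [set w | E w v] w)).
Qed.

End trees.

Section weighted_shift.
Variables (R : realType) (V : choiceType).
Implicit Types (E : rel V) (lam : V -> R[i]) (f : l2 R V).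

Definition bounded_weights E lam :=
  (ereal_sup [set \esum_(u in children E v) (cnorm (lam u) ^+ 2)%:E
             | v in [set: V]] < +oo)%E.

Lemma esum_mulr_le (D : set V) (a : V -> R) (c m : R) : 0 <= c ->
  (\esum_(v in D) (a v)%:E <= m%:E)%E ->
  (\esum_(v in D) (c * a v)%:E <= (c * m)%:E)%E.
Proof.
move=> c0 am; apply: ge_ereal_sup => _ [X [finX XD] <-].
rewrite (fsbig_finite _ _ finX)/= sumEFin -mulr_sumr lee_fin ler_wpM2l//.
rewrite -lee_fin; apply: le_trans am; apply: ereal_sup_ubound.
by exists X => //; rewrite (fsbig_finite _ _ finX)/= sumEFin.
Qed.

Lemma wshift_subproof E lam (tE : directed_tree E) (rE : rootless E)
    (bl : bounded_weights E lam) f :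
  (fun v => lam v * f (par E v)) \in @square_summable R V.
Proof.
have [m m0 bm] : exists2 m : R, 0 <= m & forall v,
    (\esum_(u in children E v) (cnorm (lam u) ^+ 2)%:E <= m%:E)%E.
  exists (Num.max 0 (fine (ereal_sup [set \esum_(u in children E v)
      (cnorm (lam u) ^+ 2)%:E | v in [set: V]]))); first by rewrite le_max lexx.
  move=> v.
  have le_sup : (\esum_(u in children E v) (cnorm (lam u) ^+ 2)%:E <=
      ereal_sup [set \esum_(u in children E v) (cnorm (lam u) ^+ 2)%:E
                | v in [set: V]])%E by apply: ereal_sup_ubound; exists v.
  apply: (le_trans le_sup).
  rewrite -[leLHS]fineK ?lee_fin ?le_max ?lexx ?orbT// ge0_fin_numE//.
  by apply: le_trans le_sup; apply: esum_ge0 => u _; rewrite lee_fin sqr_ge0.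
apply/asboolP; rewrite /sqsum.
pose a u v : \bar R := (cnorm (lam v * f u) ^+ 2)%:E.
have a0 u v : (0 <= a u v)%E by rewrite lee_fin sqr_ge0.
rewrite (_ : esum _ _ = \esum_(u in [set: V]) \esum_(v in children E u) a u v)%E;
    last first.
  rewrite esum_esum//; symmetry.
  apply: (reindex_esum [set: V] _ (fun v => (par E v, v))) => //.
  split=> [v _|v v' _ _ [_ ->]//|[u v] [_ uv]]/=.
    by split=> //; exact/(parP _ _ tE rE).
  by exists v => //; rewrite (iffLR (parP _ _ tE rE) uv).
apply: (@le_lt_trans _ _ (m * fine (sqsum f))%:E); last exact: ltry.
apply: (@le_trans _ _ (\esum_(u in [set: V]) (m * cnorm (f u) ^+ 2)%:E)%E).
  apply: le_esum => u _.
  rewrite (@eq_esum _ _ _ _ (fun v => (cnorm (f u) ^+ 2 * cnorm (lam v) ^+ 2)%:E)).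
    by rewrite mulrC; apply: esum_mulr_le; [exact: sqr_ge0|exact: bm].
  by move=> v _; rewrite /a cnormM exprMn mulrC.
apply: esum_mulr_le => //.
by rewrite sqsum_fineK ?l2_square_summable.
Qed.

Definition wshift E lam (tE : directed_tree E) (rE : rootless E)
    (bl : bounded_weights E lam) : l2 R V -> l2 R V :=
  fun f => L2 (wshift_subproof tE rE bl f).

Definition path_weight E lam (n : nat) (v : V) : R[i] :=
  \prod_(0 <= j < n) lam (iter j (par E) v).

Lemma basis_subproof (v : V) :
  (fun u => (u == v)%:R : R[i]) \in @square_summable R V.
Proof.
apply/asboolP; apply: (@le_lt_trans _ _ 1%:E); last exact: ltry.
apply: sqsum_partial_le => A; rewrite lee_fin.
have [vA|vA] := boolP (v \in A).
  rewrite (big_fsetD1 v)//= eqxx big_seq big1 => [|u].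
    by rewrite addr0 /cnorm Normc.normc1 expr1n.
  by rewrite !inE => /andP[/negPf-> _]; rewrite /cnorm Normc.normc0 expr0n.
rewrite big_seq big1// => u uA.
case: eqP vA => [<-|_ _]; first by rewrite uA.
by rewrite /cnorm Normc.normc0 expr0n.
Qed.

Definition basis_vector (v : V) : l2 R V := L2 (basis_subproof v).

End weighted_shift.

(* Main.v *)
Require Import Defs.
From HB Require Import structures.
From mathcomp Require Import all_boot all_order all_algebra finmap complex.
From mathcomp Require Import sesquilinear.
From mathcomp Require Import all_classical all_reals all_analysis.
From mathcomp Require Import ring.

Set Implicit Arguments.
Unset Strict Implicit.
Unset Printing Implicit Defensive.

Import Order.TTheory GRing.Theory Num.Theory.
Import numFieldNormedType.Exports.

Local Open Scope classical_set_scope.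
Local Open Scope ring_scope.

(** Write [S] for the shift and [e_ u] for the basis vectors.

    The operator [S^* S] is diagonal with entries [|S e_u|^2], so the modulus
    of [S] is the diagonal operator with entries [|S e_u|], and dividing each
    weight [lam v] by [|S e_(par v)|] gives the weights [mu] of another shift
    [U] with [S = U |S|]. The weights of [U] have square sum 1 over the
    children of each vertex, hence [U] is an isometry
    ([polar_decomposition_wshift]).

    Suppose that [U] maps a subspace [M] onto itself. Each [f] in [M] is
    [U^n g] with [|g| = |f|], and evaluating at [v] gives
    [|f v| <= |mu_(par^n v | v)| |f|]. So [f = 0] as soon as the path weights
    of [mu] tend to 0 ([unitary_part_eq0]). It remains to see that their
    squared moduli are exactly the ratios whose limit is assumed to be 0.

    This is where centeredness enters. The operator [S^*n S^n] is diagonal with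
    entries [D_n u = |S^n e_u|^2] ([sqr_growth_diag]), while the entry of
    [S S^*] between two siblings [v] and [w] is [lam w * (lam v)^*], which is
    not 0. As the two operators commute, [D_n] takes the same value on
    siblings ([sqr_growth_siblings]). Thus [S^*n S^n] acts on the vector
    [S e_u], which lives on the children of [u], as a scalar, and
    [D_(n+1) (par v) = D_1 (par v) * D_n v] ([sqr_growthS]). Going up along a
    path, the product of the [D_1] that separates the path weights of [lam]
    from those of [mu] telescopes to [D_n (par^n v)] ([norm_path_weight]).

    All of this uses the adjoint of [S] through its defining identity, so an
    adjoint has to be produced first ([adjoint_l2]). *)

(** * Inner products and iterated adjoints *)

Section inner_product.
Variables (R : realType) (H : hilbertType R).
Implicit Types (x y z : H) (T : H -> H).

Lemma innerZl (a : R[i]) x y : inner (a *: x) y = a * inner x y.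
Proof. by rewrite linearZl_LR. Qed.

Lemma innerZr (a : R[i]) x y : inner x (a *: y) = Num.conj a * inner x y.
Proof. by rewrite linearZr_LR. Qed.

Lemma innerC x y : inner x y = Num.conj (inner y x).
Proof. exact: dot_conj. Qed.

Lemma inner_suml (I : Type) (s : seq I) (F : I -> H) y :
  inner (\sum_(i <- s) F i) y = \sum_(i <- s) inner (F i) y.
Proof. exact: linear_sumlz. Qed.

Lemma inner_sumr (I : Type) (s : seq I) (F : I -> H) x :
  inner x (\sum_(i <- s) F i) = \sum_(i <- s) inner x (F i).
Proof. exact: linear_sumr. Qed.

Lemma inner_norm_le x y : `|inner x y| <= `|x| * `|y|.
Proof.
rewrite -(@ler_sqr R[i]) ?nnegrE ?mulr_ge0//.
by rewrite exprMn !sqr_norm_inner; exact: dot_CauchySchwarz.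
Qed.

Lemma iter_adjoint T n :
  (forall x y, inner (T x) y = inner x (adjoint T y)) ->
  forall x y, inner (iter n T x) y = inner x (iter n (adjoint T) y).
Proof. by move=> Tadj; elim: n => //= n IHn x y; rewrite Tadj IHn -iterSr. Qed.

End inner_product.

(** * Finite combinations of basis vectors *)

Section finite_combinations.
Variables (R : realType) (V : choiceType).
Implicit Types (f g : l2 R V) (u v w : V) (A : {fset V}).
Local Notation e_ := (basis_vector R).

Lemma l2_innerE f g : inner f g = csum (fun v => f v * Num.conj (g v)).
Proof. by []. Qed.

Lemma csum_single (h : V -> R[i]) u :
  (forall v, v != u -> h v = 0) -> csum h = h u.
Proof.
move=> hu; apply: csum_unique; apply: cvg_near_cst.
exists [fset u]%fset => //= A /=; rewrite fsub1set => uA.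
rewrite partial_sumE (big_fsetD1 u)//= big_seq big1 ?addr0// => v.
by rewrite !inE => /andP[/hu].
Qed.

Lemma inner_basisr f u : inner f (e_ u) = f u.
Proof.
rewrite l2_innerE (csum_single (u := u)) /= ?eqxx ?conjC1 ?mulr1// => v /negPf ->.
by rewrite conjC0 mulr0.
Qed.

Lemma inner_basisl f u : inner (e_ u) f = Num.conj (f u).
Proof. by rewrite innerC inner_basisr. Qed.

Lemma sum_sqr_norm f A :
 \sum_(u <- A) `|f u| ^+ 2 = (\sum_(u <- A) cnorm (f u) ^+ 2)%:C%C.
Proof. by rewrite rmorph_sum/=; apply: eq_bigr => v _; rewrite rmorphXn. Qed.

Definition fin_comb A (a : V -> R[i]) : l2 R V := \sum_(u <- A) a u *: e_ u.

Lemma inner_fin_comb A a f :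
  inner f (fin_comb A a) = \sum_(u <- A) Num.conj (a u) * f u.
Proof.
by rewrite inner_sumr; apply: eq_bigr => u _; rewrite innerZr inner_basisr.
Qed.

Lemma fin_combE A a v : v \in A -> fin_comb A a v = a v.
Proof.
move=> vA; rewrite -inner_basisr inner_suml (big_fsetD1 v)//= big_seq big1.
  by rewrite innerZl inner_basisr /= eqxx mulr1 addr0.
move=> u; rewrite !inE => /andP[uv _].
by rewrite innerZl inner_basisr/= eq_sym (negPf uv) mulr0.
Qed.

Lemma norm_fin_comb A a : `|fin_comb A a| ^+ 2 = \sum_(u <- A) `|a u| ^+ 2.
Proof.
rewrite sqr_norm_inner inner_fin_comb !big_seq; apply: eq_bigr => u uA.
by rewrite fin_combE// mulrC normCK.
Qed.

Lemma norm_sub_fin_comb f A :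
  `|f - fin_comb A f| ^+ 2 = `|f| ^+ 2 - \sum_(u <- A) `|f u| ^+ 2.
Proof.
have ff : inner f (fin_comb A f) = \sum_(u <- A) `|f u| ^+ 2.
  by rewrite inner_fin_comb; apply: eq_bigr => u _; rewrite mulrC normCK.
rewrite !sqr_norm_inner linearBl/= !linearBr/= -!sqr_norm_inner norm_fin_comb.
rewrite ff (innerC (fin_comb A f)) ff geC0_conj ?subrr ?subr0//.
by apply: sumr_ge0 => u _; rewrite exprn_ge0.
Qed.

Lemma norm_le_partial f (c : R[i]) : c \is Num.real ->
  (forall A, \sum_(u <- A) `|f u| ^+ 2 <= c) -> `|f| ^+ 2 <= c.
Proof.
move=> cR fc; have [r cE] : exists r : R, c = r%:C%C.
  by exists (complex.Re c); rewrite RRe_real.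
rewrite sqr_l2_norm cE lecR -lee_fin sqsum_fineK ?l2_square_summable//.
apply: sqsum_partial_le => A; rewrite lee_fin -lecR -cE -sum_sqr_norm; exact: fc.
Qed.

Lemma partial_le_norm f A : \sum_(u <- A) `|f u| ^+ 2 <= `|f| ^+ 2.
Proof. by rewrite -subr_ge0 -norm_sub_fin_comb exprn_ge0. Qed.

Lemma norm_basis v : `|e_ v| = 1.
Proof.
apply/eqP; rewrite -(@eqrXn2 _ 2)// sqr_norm_inner inner_basisr/= eqxx.
by rewrite expr1n.
Qed.

Lemma inner_disjoint f g : (forall v, f v * g v = 0) -> inner f g = 0.
Proof.
move=> fg; rewrite -[RHS](linear0r (l2_dot R V) 0) l2_innerE.
congr csum; apply/funext => v; rewrite mul0r; apply/eqP.
by rewrite mulf_eq0 conjC_eq0 -mulf_eq0 fg.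
Qed.

End finite_combinations.

(** * Existence of adjoints *)

Section adjoint.
Variables (R : realType) (V : choiceType).
Implicit Types (f g : l2 R V) (T : l2 R V -> l2 R V) (u : V) (A : {fset V}).
Local Notation e_ := (basis_vector R).

Lemma bounded_operator_ge0 T : bounded_operator T ->
  exists2 c : R[i], 0 <= c & forall x, `|T x| <= c * `|x|.
Proof.
move=> [_ [c Tc]]; exists `|c| => // x; apply: (le_trans (Tc x)).
by rewrite -[X in _ <= _ * X]normr_id -normrM ger0_norm// (le_trans _ (Tc x)).
Qed.

(** Finite combinations are dense: [phi f] only depends on the tail of [f]
    outside a finite [A], so [|phi f| / c] bounds the norm of every tail from
    below. If it were positive, the partial sums of [|f u|^2] would stay away
    from their supremum [|f|^2]. *)
Lemma bounded_functional_eq0 (phi : l2 R V -> R[i]) (c : R[i]) :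
  0 <= c -> (forall f, `|phi f| <= c * `|f|) ->
  (forall f g, phi (f - g) = phi f - phi g) ->
  (forall A a, phi (fin_comb A a) = 0) -> forall f, phi f = 0.
Proof.
move=> c0 phic phiB phi0 f.
apply/eqP; rewrite -normr_eq0; apply/negPn/negP => phif0.
have {c0}c0 : 0 < c.
  rewrite lt_def c0 andbT; apply: contraNneq phif0 => cE.
  by rewrite eq_le normr_ge0 andbT (le_trans (phic f))// cE mul0r.
have d0 : 0 < (`|phi f| / c) ^+ 2.
  by rewrite exprn_gt0// divr_gt0// lt_def phif0/=.
suff : `|f| ^+ 2 <= `|f| ^+ 2 - (`|phi f| / c) ^+ 2.
  by rewrite lerBrDr gerDl => /le_gtF; rewrite d0.
apply: norm_le_partial => [|A].
  by apply: realB; apply: ger0_real; [exact: exprn_ge0|exact: ltW].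
rewrite lerBrDl -lerBrDr -norm_sub_fin_comb lerXn2r ?nnegrE ?divr_ge0 ?(ltW c0)//.
by rewrite ler_pdivrMr// mulrC (le_trans _ (phic _))// phiB phi0 subr0.
Qed.

(** The value of the adjoint at [y] must have coordinates [inner y (T (e_ u))].
    They are square summable: testing [y] against the image under [T] of their
    own truncation [t] gives [|t|^2 <= |y| c |t|]. Both sides of the adjoint
    identity are then bounded in [x] and agree on basis vectors. *)
Lemma adjoint_l2 T : bounded_operator T ->
  forall x y, inner (T x) y = inner x (adjoint T y).
Proof.
move=> Tb; have [c c0 Tc] := bounded_operator_ge0 Tb; have [Tl _] := Tb.
pose TL := GRing.isLinear.Build _ _ _ _ T Tl.
pose TT : {linear l2 R V -> l2 R V} := HB.pack T TL.
have TfinE A a : T (fin_comb A a) = \sum_(u <- A) a u *: T (e_ u).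
  rewrite -[T]/(TT : _ -> _) linear_sum; apply: eq_bigr => u _; exact: linearZ.
suff [T' T'P] : exists T', forall x y, inner (T x) y = inner x (T' y).
  exact: (xgetI _ (T'P : [set T' | _] T')).
pose k y : V -> R[i] := fun u => inner y (T (e_ u)).
have ky y A : \sum_(u <- A) `|k y u| ^+ 2 <= (c * `|y|) ^+ 2.
  set N := \sum_(u <- A) _; have N0 : 0 <= N.
    by apply: sumr_ge0 => u _; rewrite exprn_ge0.
  have : N <= `|y| * (c * sqrtC N).
    have NE : inner y (T (fin_comb A (k y))) = N.
      rewrite TfinE inner_sumr; apply: eq_bigr => u _.
      by rewrite innerZr mulrC normCK.
    rewrite -[leLHS]ger0_norm// -NE (le_trans (inner_norm_le _ _))// ler_wpM2l//.
    rewrite (le_trans (Tc _))// ler_wpM2l// NE.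
    rewrite -(@ler_sqr R[i]) ?nnegrE//; last by rewrite sqrtC_ge0.
    by rewrite norm_fin_comb sqrtCK.
  rewrite mulrA [X in _ <= X * _]mulrC -{1}[N]sqrtCK.
  have [+ _|] := eqVneq (sqrtC N) 0.
    move=> sN; have -> : N = 0 by rewrite -[N]sqrtCK sN expr0n.
    by rewrite exprn_ge0// mulr_ge0.
  move=> sN0; have {}sN0 : 0 < sqrtC N by rewrite lt_def sN0 sqrtC_ge0.
  rewrite expr2 ler_pM2r// => sN; rewrite -[N]sqrtCK lerXn2r ?nnegrE ?mulr_ge0//.
  exact: ltW.
have ks y : k y \in @square_summable R V.
  have cy : c * `|y| \is Num.real by rewrite realE mulr_ge0.
  apply/asboolP.
  apply: (@le_lt_trans _ _ (complex.Re (c * `|y|) ^+ 2)%:E); last exact: ltry.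
  apply: sqsum_partial_le => A; rewrite lee_fin -lecR rmorphXn/=.
  rewrite RRe_real//; apply: le_trans (ky y A).
  by rewrite rmorph_sum/=; apply: ler_sum => u _; rewrite rmorphXn.
exists (fun y => L2 (ks y)) => x y; apply/eqP; rewrite -subr_eq0; apply/eqP.
apply: (@bounded_functional_eq0 (fun x => inner (T x) y - inner x (L2 (ks y)))
  (c * `|y| + `|L2 (ks y)|)) => {x} [|x|x z|A a].
- by rewrite addr_ge0// mulr_ge0.
- rewrite (le_trans (ler_normB _ _))// mulrDl lerD//.
    apply: (le_trans (inner_norm_le _ _)); rewrite mulrAC.
    by apply: ler_wpM2r => //; exact: Tc.
  by rewrite [leRHS]mulrC; exact: inner_norm_le.
- have -> : T (x - z) = T x - T z by exact: (linearB TT).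
  by rewrite !linearBl/=; ring.
- rewrite TfinE !inner_suml -sumrB big1// => u _.
  by rewrite !innerZl -mulrBr inner_basisl/= /k -innerC subrr mulr0.
Qed.

End adjoint.

(** * Diagonal operators *)

Section diagonal.
Variables (R : realType) (V : choiceType).
Implicit Types (f g : l2 R V) (d : V -> R[i]) (v : V) (A : {fset V}).

Definition bounded_coefs d := exists c : R[i], forall v, `|d v| <= c.

Lemma diag_subproof d (bd : bounded_coefs d) f :
  (fun v => d v * f v) \in @square_summable R V.
Proof.
have [c dc] := bd; apply/asboolP.
apply: (@le_lt_trans _ _ (complex.Re c ^+ 2 * fine (sqsum f))%:E).
  2: exact: ltry.
apply: sqsum_partial_le => A; rewrite lee_fin.
apply: le_trans (ler_wpM2l (sqr_ge0 _)
  (partial_le_sqsum A (l2_square_summable f))).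
rewrite mulr_sumr; apply: ler_sum => v _; rewrite cnormM exprMn.
have cdc : cnorm (d v) <= complex.Re c.
  have cR : c \is Num.real by rewrite ger0_real// (le_trans _ (dc v)).
  rewrite -lecR RRe_real//; exact: dc.
rewrite ler_wpM2r ?sqr_ge0// lerXn2r ?nnegrE ?cnorm_ge0//.
by rewrite (le_trans (cnorm_ge0 (d v))).
Qed.

Definition diag d (bd : bounded_coefs d) f : l2 R V := L2 (diag_subproof bd f).

Lemma diag_bounded d (bd : bounded_coefs d) : bounded_operator (diag bd).
Proof.
split=> [a f g|].
  apply/l2P/funext => v; rewrite -[LHS]/(d v * (a * f v + g v)).
  by rewrite -[RHS]/(a * (d v * f v) + d v * g v); ring.
have [c dc] := bd; exists `|c| => f.
rewrite -(@ler_sqr R[i]) ?nnegrE ?mulr_ge0//; apply: norm_le_partial => [|A].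
  by rewrite ger0_real// exprn_ge0// mulr_ge0.
rewrite exprMn (le_trans _ (ler_wpM2l _ (partial_le_norm f A))) ?exprn_ge0//.
rewrite mulr_sumr; apply: ler_sum => v _ /=; rewrite normrM exprMn.
rewrite ler_wpM2r ?exprn_ge0// lerXn2r ?nnegrE//.
by rewrite [leRHS]ger0_norm// (le_trans _ (dc v)).
Qed.

(** With [q = sqrt d], [inner (d f) f = inner (q f) (q f)]. *)
Lemma diag_positive d (bd : bounded_coefs d) : (forall v, 0 <= d v) ->
  positive_operator (diag bd).
Proof.
move=> d0; split=> [|f]; first exact: diag_bounded.
have bq : bounded_coefs (fun v => sqrtC (d v)).
  have [c dc] := bd; exists (sqrtC c) => v.
  rewrite ger0_norm ?sqrtC_ge0// ler_sqrtC ?qualifE/=//.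
    by rewrite -(ger0_norm (d0 v)).
  by rewrite (le_trans _ (dc v)).
rewrite (_ : inner _ _ = inner (diag bq f) (diag bq f)) ?dot_ge0//.
rewrite !l2_innerE; congr csum; apply/funext => v /=.
rewrite rmorphM/= (geC0_conj (x := sqrtC _)) ?sqrtC_ge0// mulrACA -expr2 sqrtCK.
by rewrite mulrA.
Qed.

End diagonal.

(** * Weighted shifts *)

Lemma esum_mulr (R : realType) (T : choiceType) (D : set T) (a : T -> R)
    (c m : R) :
  0 <= c -> (forall v, 0 <= a v) -> \esum_(v in D) (a v)%:E = m%:E ->
  \esum_(v in D) (c * a v)%:E = (c * m)%:E.
Proof.
move=> c0 a0 am; have le_m : (\esum_(v in D) (c * a v)%:E <= (c * m)%:E)%E.
  by apply: esum_mulr_le; rewrite ?am.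
apply/le_anti; rewrite le_m/=.
have [->|cn0] := eqVneq c 0.
  by rewrite esum1 ?mul0r// => v _; rewrite mul0r.
have {cn0}c0 : 0 < c by rewrite lt_def cn0.
have fin : (\esum_(v in D) (c * a v)%:E \is a fin_num).
  rewrite ge0_fin_numE; first exact: le_lt_trans le_m (ltry _).
  by apply: esum_ge0 => v _; rewrite lee_fin mulr_ge0// ltW.
rewrite -[leRHS]fineK// lee_fin -ler_pdivlMl//.
rewrite -lee_fin -am.
rewrite (eq_esum (b := fun v => (c^-1 * (c * a v))%:E)) => [|v _]; last first.
  by rewrite mulKf// gt_eqF.
by apply: esum_mulr_le; rewrite ?invr_ge0 ?(ltW c0)// fineK.
Qed.

Section weighted_shift.
Variables (R : realType) (V : choiceType) (E : rel V).
Hypotheses (tE : directed_tree E) (rE : rootless E).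
Implicit Types (f g : l2 R V) (lam : V -> R[i]) (u v w : V) (n : nat).
Local Notation e_ := (basis_vector R).
Local Notation par := (par E).

Lemma path_weightSl lam n v :
  path_weight E lam n.+1 v = lam v * path_weight E lam n (par v).
Proof.
rewrite /path_weight big_nat_recl//; congr (_ * _).
by apply: eq_bigr => j _; rewrite iterSr.
Qed.

Lemma path_weightSr lam n v :
  path_weight E lam n.+1 v = path_weight E lam n v * lam (iter n par v).
Proof. by rewrite /path_weight big_nat_recr. Qed.

Lemma iter_wshiftE lam (bl : bounded_weights E lam) n f v :
  iter n (wshift tE rE bl) f v = path_weight E lam n v * f (iter n par v).
Proof.
elim: n v => [|n IHn] v; first by rewrite /path_weight big_nil mul1r.
by rewrite path_weightSl iterS -[LHS]/(lam v * _ (par v)) IHn mulrA -iterSr.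
Qed.

Lemma wshift_linear lam (bl : bounded_weights E lam) : linear (wshift tE rE bl).
Proof.
move=> a f g; apply/l2P/funext => v.
rewrite -[LHS]/(lam v * (a * f (par v) + g (par v))).
by rewrite -[RHS]/(a * (lam v * f (par v)) + lam v * g (par v)); ring.
Qed.

Lemma wshift_eq0 (lE : leafless E) lam (bl : bounded_weights E lam)
    (lam_neq0 : forall v, lam v != 0) f :
  wshift tE rE bl f = 0 -> f = 0.
Proof.
move=> Sf0; apply/l2P/funext => u; have [v /(parP _ _ tE rE) vu] := lE u.
have : lam v * f (par v) = 0 by rewrite -[LHS]/(wshift tE rE bl f v) Sf0.
by rewrite vu => /eqP; rewrite mulf_eq0 (negPf (lam_neq0 v)) => /eqP.
Qed.

Lemma sqsum_wshift_basis lam (bl : bounded_weights E lam) u :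
  sqsum (wshift tE rE bl (e_ u)) =
  (\esum_(v in children E u) (cnorm (lam v) ^+ 2)%:E)%E.
Proof.
rewrite /sqsum [RHS]esum_mkcond; apply: eq_esum => v _ /=.
have [uv|uv] := boolP (v \in children E u).
  by move: uv; rewrite inE => /(parP _ _ tE rE) ->; rewrite eqxx mulr1.
rewrite (_ : par v == u = false) ?mulr0.
  by rewrite /cnorm Normc.normc0 expr0n.
apply: contraNF uv => /eqP vu; rewrite inE; exact/(parP _ _ tE rE).
Qed.

(** Grouping the vertices by their parent, the square sum of the image of [f]
    is the sum over [u] of [|f u|^2] times the square sum of the weights of the
    children of [u]. *)
Lemma wshift_isometric lam (bl : bounded_weights E lam) :
  (forall u, (\esum_(v in children E u) (cnorm (lam v) ^+ 2)%:E = 1%:E)%E) ->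
  isometric_operator (wshift tE rE bl).
Proof.
move=> lam1.
have Sn f : `|wshift tE rE bl f| = `|f|.
  apply/eqP; rewrite -(@eqrXn2 _ 2)// !sqr_l2_norm; apply/eqP.
  congr ((fine _)%:C%C).
  rewrite /sqsum; pose a u v : \bar R := (cnorm (lam v * f u) ^+ 2)%:E.
  rewrite (_ : esum _ _ =
      \esum_(u in [set: V]) \esum_(v in children E u) a u v)%E; last first.
    rewrite esum_esum//; last by move=> *; rewrite lee_fin sqr_ge0.
    symmetry; apply: (reindex_esum [set: V] _ (fun v => (par v, v))) => //.
    split=> [v _|v v' _ _ [_ ->]//|[u v] [_ uv]]/=.
      by split=> //; exact/(parP _ _ tE rE).
    by exists v => //; rewrite (iffLR (parP _ _ tE rE) uv).
  apply: eq_esum => u _; rewrite /a -[in RHS](mulr1 (_ ^+ 2)).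
  rewrite -(esum_mulr _ _ (lam1 u)) ?sqr_ge0//; last by move=> v; exact: sqr_ge0.
  by apply: eq_esum => v _; rewrite cnormM exprMn mulrC.
split=> //; split; first exact: wshift_linear.
by exists 1 => f; rewrite mul1r Sn.
Qed.

End weighted_shift.

(** * Centered weighted shifts *)

Section centered_shift.
Variables (R : realType) (V : choiceType) (E : rel V).
Variable (lam : V -> R[i]).
Hypotheses (tE : directed_tree E) (rE : rootless E) (lE : leafless E).
Hypotheses (bl : bounded_weights E lam) (lam_neq0 : forall v, lam v != 0).
Implicit Types (f g : l2 R V) (u v w : V) (A : {fset V}) (n : nat).
Local Notation e_ := (basis_vector R).
Local Notation par := (par E).
Local Notation S := (wshift tE rE bl).
Hypothesis bS : bounded_operator S.
Let adj n := iter_adjoint n (adjoint_l2 bS).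

Definition sqr_growth n u : R[i] := `|iter n S (e_ u)| ^+ 2.

Lemma sqr_growth0 u : sqr_growth 0 u = 1.
Proof. by rewrite /sqr_growth norm_basis expr1n. Qed.

Lemma sqr_growth_ge0 n u : 0 <= sqr_growth n u. Proof. exact: exprn_ge0. Qed.

(** The vectors [S^n e_v] and [S^n e_w] have disjoint supports when [v != w],
    as these lie in the [n]-th generations below [v] and below [w]; so
    [S^*n S^n] multiplies [e_ w] by a scalar, and, being self-adjoint, the
    coordinate at [w] of every vector by the same scalar. *)
Lemma sqr_growth_diag n f w :
  iter n (adjoint S) (iter n S f) w = sqr_growth n w * f w.
Proof.
have BE g : iter n (adjoint S) (iter n S g) w =
    inner g (iter n (adjoint S) (iter n S (e_ w))).
  by rewrite -inner_basisr innerC -!adj -innerC.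
suff Be : iter n (adjoint S) (iter n S (e_ w)) = sqr_growth n w *: e_ w.
  by rewrite BE Be innerZr inner_basisr geC0_conj// sqr_growth_ge0.
apply/l2P/funext => v; rewrite -[RHS]/(sqr_growth n w * (v == w)%:R).
rewrite -inner_basisr innerC -adj -innerC.
have [->|vw] := eqVneq v w; first by rewrite mulr1 -sqr_norm_inner.
rewrite mulr0; apply: inner_disjoint => x; rewrite !iter_wshiftE/=.
have [xv|_] := eqVneq (iter n par x) v; last by rewrite !(mulr0, mul0r).
by rewrite xv (negPf vw) ?(mulr0, mul0r).
Qed.

Lemma inner_basis_wshift v u :
  inner (e_ v) (S (e_ u)) = Num.conj (lam v * (par v == u)%:R).
Proof. by rewrite inner_basisl. Qed.

Lemma adjoint_wshiftE f u : adjoint S f u = inner f (S (e_ u)).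
Proof. by rewrite -inner_basisr innerC -(adj 1) -innerC. Qed.

(** Let [A = S S^*], and let [B = S^*n S^n], which is diagonal. Compare the
    coordinates at [w] of [B (A e_v)] and [A (B e_v)]: they
    are [lam w * (lam v)^*], which is not 0, times the diagonal entry of [B] at
    [w] and at [v] respectively. *)
Lemma sqr_growth_siblings n v w :
  centered S -> par v = par w -> sqr_growth n v = sqr_growth n w.
Proof.
case: n => [|n] cS vw; first by rewrite !sqr_growth0.
have [_ comm] := cS.
set B := iter n.+1 (adjoint S) \o iter n.+1 S.
have /(congr1 (fun T : l2 R V -> l2 R V => T (e_ v) w)) :
    B \o (S \o adjoint S) = (S \o adjoint S) \o B.
  by apply: comm; [exists n.+1 => //; right|exists 1 => //; left].
rewrite -[LHS]/(B (S (adjoint S (e_ v))) w).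
rewrite -[RHS]/(lam w * adjoint S (B (e_ v)) (par w)).
rewrite sqr_growth_diag.
have -> : B (e_ v) = sqr_growth n.+1 v *: e_ v.
  apply/l2P/funext => x; rewrite sqr_growth_diag.
  rewrite -[RHS]/(sqr_growth _ _ * (x == v)%:R).
  by have [->|] := eqVneq x v; rewrite /= ?eqxx// => /negPf ->; rewrite !mulr0.
rewrite -[X in sqr_growth _ _ * X]/(lam w * adjoint S (e_ v) (par w)).
rewrite !adjoint_wshiftE innerZl inner_basis_wshift vw eqxx mulr1 => H.
have nz : lam w * Num.conj (lam v) != 0 by rewrite mulf_neq0 ?conjC_eq0.
apply: (mulIf nz); rewrite H; ring.
Qed.

(** [S e_(par v)] is supported on the siblings of [v], where the entries of
    [S^*n S^n] are all equal to that at [v]; so it is an eigenvector. *)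
Lemma sqr_growthS n v : centered S ->
  sqr_growth n.+1 (par v) = sqr_growth 1 (par v) * sqr_growth n v.
Proof.
move=> cS; rewrite {1}/sqr_growth sqr_norm_inner iterSr adj.
have -> : iter n (adjoint S) (iter n S (S (e_ (par v)))) =
    sqr_growth n v *: S (e_ (par v)).
  apply/l2P/funext => w; rewrite sqr_growth_diag.
  rewrite -[RHS]/(sqr_growth n v * (lam w * (par w == par v)%:R)).
  rewrite -[X in _ * X = _]/(lam w * (par w == par v)%:R).
  have [/(sqr_growth_siblings n cS) -> //|_] := eqVneq (par w) (par v).
  by rewrite !mulr0.
by rewrite innerZr geC0_conj ?sqr_growth_ge0// mulrC /sqr_growth -sqr_norm_inner.
Qed.

End centered_shift.

(** * The polar decomposition and its isometric factor *)

Section polar_decomposition.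
Variables (R : realType) (V : choiceType) (E : rel V).
Variable (lam : V -> R[i]).
Hypotheses (tE : directed_tree E) (rE : rootless E) (lE : leafless E).
Hypotheses (bl : bounded_weights E lam) (lam_neq0 : forall v, lam v != 0).
Implicit Types (f g : l2 R V) (u v w : V) (A : {fset V}) (n : nat).
Local Notation e_ := (basis_vector R).
Local Notation par := (par E).
Local Notation S := (wshift tE rE bl).
Hypothesis bS : bounded_operator S.

Definition modulus_weight u : R[i] := `|S (e_ u)|.
Definition iso_weight v : R[i] := lam v / modulus_weight (par v).

Lemma modulus_weight_gt0 u : 0 < modulus_weight u.
Proof.
rewrite normr_gt0; apply/negP => /eqP /(wshift_eq0 lE lam_neq0).
by move=> /(congr1 (fun f : l2 R V => f u))/eqP; rewrite /= eqxx oner_eq0.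
Qed.

Lemma modulus_weight_bounded : bounded_coefs modulus_weight.
Proof.
have [_ [c Sc]] := bS; exists c => u.
by rewrite /modulus_weight normr_id (le_trans (Sc _))// norm_basis mulr1.
Qed.

Lemma iso_weightK v : iso_weight v * modulus_weight (par v) = lam v.
Proof. by rewrite divfK// gt_eqF// modulus_weight_gt0. Qed.

Lemma esum_iso_weight u :
  (\esum_(v in children E u) (cnorm (iso_weight v) ^+ 2)%:E = 1%:E)%E.
Proof.
have m0 : 0 < cnorm (modulus_weight u) ^+ 2.
  by rewrite exprn_gt0// -ltcR cnormE normr_gt0 gt_eqF// modulus_weight_gt0.
have sumE : \esum_(v in children E u) (cnorm (lam v) ^+ 2)%:E =
    (cnorm (modulus_weight u) ^+ 2)%:E.
  rewrite -sqsum_wshift_basis -sqsum_fineK ?l2_square_summable//; congr _%:E.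
  apply: complexI; rewrite -sqr_l2_norm rmorphXn/= cnormE /modulus_weight.
  by rewrite normr_id.
rewrite -(mulVf (lt0r_neq0 m0)).
rewrite -(esum_mulr _ (fun v => sqr_ge0 _) sumE) ?invr_ge0 ?(ltW m0)//.
apply: eq_esum => v /(parP _ _ tE rE) vu.
by rewrite -[lam v]iso_weightK vu cnormM exprMn mulrCA mulVf ?mulr1// gt_eqF.
Qed.

Lemma iso_weight_bounded : bounded_weights E iso_weight.
Proof.
apply: (@le_lt_trans _ _ 1%:E); last exact: ltry.
by apply: ge_ereal_sup => _ [u _ <-]; rewrite esum_iso_weight.
Qed.

Definition isometric_factor := wshift tE rE iso_weight_bounded.

Lemma isometric_factorP : isometric_operator isometric_factor.
Proof. by apply: wshift_isometric => u; exact: esum_iso_weight. Qed.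

(** By the case [n = 1] of [sqr_growth_diag], [S^* S] is the square of the
    diagonal factor. The kernels agree because both are 0: for [S], every
    vertex has a child and no weight vanishes. *)
Lemma polar_decomposition_wshift :
  polar_decomposition S isometric_factor (diag modulus_weight_bounded).
Proof.
have [bU Un] := isometric_factorP.
split.
- split.
    by apply: diag_positive => u; rewrite ltW// modulus_weight_gt0.
  apply/funext => f; apply/l2P/funext => u.
  rewrite -[RHS]/(iter 1 (adjoint S) (iter 1 S f) u) sqr_growth_diag//.
  by rewrite /sqr_growth expr2 -mulrA.
- by split=> // x _.
- move=> f; split=> [/(congr1 Num.norm)|/(wshift_eq0 lE lam_neq0) ->].
    rewrite Un normr0 => /eqP; rewrite normr_eq0 => /eqP ->.
    have [c _ /(_ 0)] := bounded_operator_ge0 bS.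
    by rewrite normr0 mulr0 normr_le0 => /eqP.
  by apply/eqP; rewrite -normr_eq0 Un normr0.
- apply/funext => f; apply/l2P/funext => v.
  rewrite -[RHS]/(iso_weight v * (modulus_weight (par v) * f (par v))).
  by rewrite mulrA iso_weightK.
Qed.

Lemma iter_wshift_eq0 n f : iter n S f = 0 -> f = 0.
Proof. by elim: n => // n IHn /(wshift_eq0 lE lam_neq0)/IHn. Qed.

Lemma sqr_growth_neq0 n u : sqr_growth tE rE bl n u != 0.
Proof.
rewrite sqrf_eq0 normr_eq0; apply/negP => /eqP/iter_wshift_eq0/eqP.
by rewrite -normr_eq0 norm_basis oner_eq0.
Qed.

Lemma norm_path_weight n v : centered S ->
  `|path_weight E lam n v| ^+ 2 =
  `|path_weight E iso_weight n v| ^+ 2 * sqr_growth tE rE bl n (iter n par v).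
Proof.
move=> cS; elim: n => [|n IHn].
  by rewrite sqr_growth0 mulr1 /path_weight !big_nil.
rewrite !path_weightSr -(iso_weightK (iter n par v)) iterS sqr_growthS//.
rewrite !(normrM (path_weight _ _ _ _)) (normrM (iso_weight _)) !exprMn IHn.
by rewrite /sqr_growth /modulus_weight normr_id/=; ring.
Qed.

(** Pulling [f] back [n] times inside [M] gives [g n] of the same norm, and
    [f v] is [g n] at the [n]-th ancestor of [v] times the path weight. *)
Lemma unitary_part_eq0 (M : set (l2 R V)) f :
  (forall v, (fun n => `|path_weight E iso_weight n v| ^+ 2 : R[i]^o) @ \oo -->
    (0 : R[i]^o)) ->
  unitary_on isometric_factor M -> M f -> f = 0.
Proof.
move=> w0 [MM Mn] Mf; apply/l2P/funext => v.
have [g gP] : exists g : nat -> l2 R V, forall n,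
    iter n isometric_factor (g n) = f /\ `|g n| = `|f|.
  suff : forall n, exists g,
      [/\ M g, iter n isometric_factor g = f & `|g| = `|f|].
    by move=> /choice[g gP]; exists g => n; have [] := gP n.
  elim=> [|n [g [Mg gf ng]]]; first by exists f.
  move: (Mg); rewrite -{1}MM => -[h Mh hg]; exists h; split => //.
    by rewrite iterSr hg.
  by rewrite -ng -hg Mn.
have fv n : `|f v| ^+ 2 <= `|path_weight E iso_weight n v| ^+ 2 * `|f| ^+ 2.
  have [<- <-] := gP n; rewrite iter_wshiftE normrM exprMn ler_wpM2l ?exprn_ge0//.
  by rewrite lerXn2r ?nnegrE// coord_le_l2_norm.
apply/eqP; rewrite -normr_eq0 -sqrf_eq0; apply/negPn/negP => fv0.
have {}fv0 : 0 < `|f v| ^+ 2 by rewrite lt_def fv0 exprn_ge0.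
have f0 : 0 < `|f| ^+ 2.
  by apply: (lt_le_trans fv0); rewrite lerXn2r ?nnegrE// coord_le_l2_norm.
(* Below this threshold the path weight forces [|f v|^2 <= |f v|^2 / 2]. *)
have e0 : 0 < `|f v| ^+ 2 / `|f| ^+ 2 / 2 by rewrite !divr_gt0.
have /cvgrPdist_le/(_ _ e0)/filter_ex[n] := w0 v.
rewrite sub0r normrN ger0_norm ?exprn_ge0// => /(ler_wpM2r (ltW f0)) wn.
have := le_trans (fv n) wn; rewrite mulrAC divfK ?gt_eqF//.
by rewrite ler_pdivlMr// mulr_natr mulr2n gerDl => /le_gtF; rewrite fv0.
Qed.

Lemma isometric_factor_pure :
  (forall v, (fun n => `|path_weight E iso_weight n v| ^+ 2 : R[i]^o) @ \oo -->
    (0 : R[i]^o)) ->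
  pure_isometry isometric_factor.
Proof.
move=> w0; split=> [|M [[_ M0 _] _ _] uM]; first exact: isometric_factorP.
by apply/seteqP; split=> f /=; [exact: (unitary_part_eq0 w0 uM)|move->].
Qed.

End polar_decomposition.

Theorem proposition22 (R : realType) (V : choiceType) (E : rel V)
    (lam : V -> R[i])
    (tE : directed_tree E) (rE : rootless E) (lE : leafless E)
    (bl : bounded_weights E lam) (lam_neq0 : forall v, lam v != 0)
    (cS : centered (wshift tE rE bl))
    (lim0 : forall v : V,
      (fun n : nat =>
         `|path_weight E lam n v| ^+ 2
         / `|iter n (wshift tE rE bl) (basis_vector R (iter n (par E) v))| ^+ 2
         : R[i]^o) @ \oo --> (0 : R[i]^o)) :
  type_I_centered (wshift tE rE bl).
Proof.
have [bS _] := cS; split=> //.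
exists (isometric_factor tE rE lE bl lam_neq0).
exists (diag (modulus_weight_bounded bS)); split.
  exact: polar_decomposition_wshift.
apply: isometric_factor_pure => v.
rewrite [X in X @ _](_ : _ = fun n => `|path_weight E lam n v| ^+ 2
    / `|iter n (wshift tE rE bl) (basis_vector R (iter n (par E) v))| ^+ 2).
  exact: lim0.
apply/funext => n; rewrite (norm_path_weight lE lam_neq0 bS n v cS) mulfK//.
exact: sqr_growth_neq0.
Qed.
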